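(* Let $n\ge 2$. If $\mathcal{L}$ is an arbitrary polynomial pencil in $\mathcal{H}_n$ (i.e. a polynomial pencil in $\mathcal{R}_n$ that is contained in $\mathcal{H}_n$) and $T\in\mathcal{A}_n(\mathbb{R})$, then the restriction to $\mathcal{L}$ of the $T$-twisted root map, $\mathcal{Z}\circ T|_{\mathcal{L}}:\mathcal{L}\to\mathbb{R}^n/\Sigma_n$, is Gårding convex.
   Context: $\mathbb{C}[x]$ is the complex vector space of polynomials. $\mathcal{C}_n$ is the set of monic complex polynomials of degree $n$, $\mathcal{R}_n\subset\mathcal{C}_n$ the monic real polynomials of degree $n$, and $\mathcal{H}_n\subset\mathcal{R}_n$ the monic polynomials of degree $n$ all of whose zeros are real (monic hyperbolic polynomials). For $P\in\mathcal{C}_n$, $\mathcal{Z}(P)\in\mathbb{C}^n/\Sigma_n$ is the unordered $n$-tuple of zeros of $P$ counted with multiplicity ($\Sigma_n$ is the symmetric group); the map $\mathcal{Z}$ is the root map. $\mathcal{A}_n(\mathbb{R})$ is the set of linear maps $T:\mathbb{C}[x]\to\mathbb{C}[x]$ with $T(\mathcal{H}_n)\subseteq\mathcal{H}_n$. The $T$-twisted root map is $\mathcal{Z}\circ T$. A polynomial pencil in $\mathcal{R}_n$ is a real line $\{(1-\lambda)P_1+\lambda P_2\mid\lambda\in\mathbb{R}\}$ through two distinct $P_1,P_2\in\mathcal{R}_n$. For a convex subset $K$ of a vector space, a map $f:K\to\mathbb{R}^n/\Sigma_n$, $f(\mathbf{x})=(f_1(\mathbf{x}),\ldots,f_n(\mathbf{x}))$,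 is called Gårding convex if $\mathbf{x}\mapsto\max_{1\le i\le n}f_i(\mathbf{x})$ is a convex function on $K$. *)

(* Defs.v *)
From HB Require Import structures.
Set Warnings "-notation-overridden,-ambiguous-paths".
From mathcomp Require Export all_boot all_order all_algebra.
From mathcomp Require Export boolp classical_sets interval_inference reals convex.
From mathcomp Require Export complex generic_quotient.

#[export] Set Implicit Arguments.
#[export] Unset Strict Implicit.
#[export] Unset Printing Implicit Defensive.

Export Order.TTheory GRing.Theory Num.Theory.

Open Scope classical_set_scope.
Open Scope ring_scope.
Open Scope complex_scope.

Lemma perm_tuple_equiv (T : eqType) (n : nat) :
  equiv_class_of (fun s t : n.-tuple T => perm_eq s t).
Proof.
split=> [s|s t|s t u]; [exact: perm_refl|exact: perm_sym|exact: perm_trans].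
Qed.

Canonical perm_tuple_rel (T : eqType) (n : nat) :=
  EquivRelPack (perm_tuple_equiv T n).

(* The quotient T^n / Sigma_n of n-tuples by permutation of their entries. *)
Definition symtuple (n : nat) (T : choiceType) :=
  {eq_quot perm_tuple_rel T n}%qT.

Definition sympi (n : nat) (T : choiceType) (t : n.-tuple T) : symtuple n T :=
  (\pi_(symtuple n T) t)%qT.

Lemma eq_sympi (n : nat) (T : choiceType) (s t : n.-tuple T) :
  (sympi s = sympi t) <-> perm_eq s t.
Proof.
split=> [/eqquotP //|st]; apply/eqquotP; exact: st.
Qed.

Lemma repr_sympi (n : nat) (T : choiceType) (t : n.-tuple T) :
  perm_eq (repr (sympi t)) t.
Proof. by apply/eq_sympi; rewrite /sympi reprK. Qed.

Definition symmap (n : nat) (T U : choiceType) (f : T -> U)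
    (s : symtuple n T) : symtuple n U :=
  sympi (map_tuple f (repr s)).

Lemma symmap_pi (n : nat) (T U : choiceType) (f : T -> U) (t : n.-tuple T) :
  symmap f (sympi t) = sympi (map_tuple f t).
Proof. by apply/eq_sympi; apply: perm_map; exact: repr_sympi. Qed.

Lemma symmap_inj (n : nat) (T U : choiceType) (f : T -> U) :
  injective f -> injective (@symmap n T U f).
Proof.
move=> fI s t /eq_sympi /(perm_map_inj fI) /eq_sympi.
by rewrite /sympi !reprK.
Qed.

(* The default head 0 s only matters for s = [::], where the value is 0. *)
Definition seqmax (R : realDomainType) (s : seq R) : R :=
  \big[Num.max/head 0 s]_(x <- s) x.

Definition symmax (n : nat) (R : realDomainType) (s : symtuple n R) : R :=
  seqmax (repr s).

Lemma seqmaxP (R : realDomainType) (s : seq R) : s != [::] ->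
  seqmax s \in s /\ (forall x, x \in s -> x <= seqmax s).
Proof.
case: s => // a s _; split; last first.
  by move=> x xs; rewrite /seqmax; exact: (le_bigmax_seq (head 0 (a :: s)) x xpredT id).
rewrite /seqmax big_seq; apply: (big_ind (fun y => y \in a :: s)) => //.
  exact: mem_head.
by move=> x y xs ys; case: leP.
Qed.

Lemma symmax_pi (n : nat) (R : realDomainType) (t : n.-tuple R) :
  symmax (sympi t) = seqmax t.
Proof.
rewrite /symmax; move: (repr_sympi t).
move: (tval (repr (sympi t))) (tval t) => s u su.
have [s0|s0] := eqVneq s [::].
  by move: su; rewrite s0 perm_sym => /perm_nilP ->.
have u0 : u != [::] by rewrite -size_eq0 -(perm_size su) size_eq0.
have [ms les] := seqmaxP s0; have [mu leu] := seqmaxP u0.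
by apply/le_anti; rewrite leu -?(perm_mem su) // les // (perm_mem su).
Qed.

(* Restriction of scalars: the complex vector space E seen as a real one, so
   that convexity in E makes sense. *)
Definition realify (R : rcfType) (E : lmodType R[i]) : Type := E.

Section Realify.
Variables (R : rcfType) (E : lmodType R[i]).

HB.instance Definition _ := GRing.Zmodule.on (realify E).

Let rscale (a : R) (x : realify E) : realify E := a%:C *: (x : E).

Let rscaleA a b x : rscale a (rscale b x) = rscale (a * b) x.
Proof. by rewrite /rscale scalerA rmorphM. Qed.

Let rscale1 : left_id 1 rscale.
Proof. by move=> x; rewrite /rscale rmorph1 scale1r. Qed.

Let rscaleDr : right_distributive rscale +%R.
Proof. by move=> a x y; rewrite /rscale scalerDr. Qed.

Let rscaleDl x : {morph rscale^~ x : a b / a + b}.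
Proof. by move=> a b; rewrite /rscale rmorphD scalerDl. Qed.

HB.instance Definition _ := GRing.Zmodule_isLmodule.Build R (realify E)
  rscaleA rscale1 rscaleDr rscaleDl.

Lemma realify_scaleE (a : R) (x : E) :
  (a *: (x : realify E) : realify E) = a%:C *: x.
Proof. by []. Qed.

End Realify.

(* f is a map K -> R^n / Sigma_n: its values outside K are irrelevant. *)
Definition garding_convex (R : realType) (E : lmodType R) (n : nat)
    (K : set E) (f : E -> symtuple n R) : Prop :=
  convex_set K /\ convex_function K (fun x => symmax (f x)).

Section Polynomials.
Variable R : realType.
Implicit Type P : {poly R[i]}.

Definition monic_poly (n : nat) : set {poly R[i]} :=
  [set P | P \is monic /\ size P = n.+1].

Definition real_monic_poly (n : nat) : set {poly R[i]} :=
  [set P | monic_poly n P /\ P \is a polyOver Num.real].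

Definition hyperbolic_poly (n : nat) : set {poly R[i]} :=
  [set P | real_monic_poly n P /\ forall z, root P z -> z \is Num.real].

(* The zeros of P with multiplicity. Only meaningful on [monic_poly n], where
   [closed_field_poly_normal] lists n zeros; see [root_map_prod]. *)
Definition root_map (n : nat) P : symtuple n R[i] :=
  sympi (insubd (nseq_tuple n 0) (sval (closed_field_poly_normal P))).

Lemma monic_poly_prod (n : nat) P : monic_poly n P ->
  exists t : n.-tuple R[i], P = \prod_(z <- t) ('X - z%:P).
Proof.
move=> [Pm Ps]; have [r Pr] := closed_field_poly_normal P.
move: Pr; rewrite (monicP Pm) scale1r => Pr.
have rn : size r == n.
  by move: Ps; rewrite Pr size_prod_XsubC => -[->].
by exists (Tuple rn).
Qed.

Lemma root_map_prod (n : nat) (t : n.-tuple R[i]) :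
  root_map n (\prod_(z <- t) ('X - z%:P)) = sympi t.
Proof.
rewrite /root_map; case: closed_field_poly_normal => r /=.
rewrite (monicP (monic_prod_XsubC _ _ _)) scale1r => rt.
have {}rt : perm_eq r t.
  exact/prod_XsubC_eq/esym.
have rn : size r == n by rewrite (perm_size rt) size_tuple.
by apply/eq_sympi; rewrite insubdK.
Qed.

(* The set written A_n(R) in the literature. *)
Definition hyperbolicity_preserver (n : nat)
    (T : {linear {poly R[i]} -> {poly R[i]}}) : Prop :=
  T @` hyperbolic_poly n `<=` hyperbolic_poly n.

Definition pencil (n : nat) (L : set {poly R[i]}) : Prop :=
  exists P1 P2, [/\ real_monic_poly n P1, real_monic_poly n P2, P1 <> P2 &
    L = [set (1 - l)%:C *: P1 + l%:C *: P2 | l in [set: R]]].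

End Polynomials.

(* Main.v *)
Require Import Defs.
From mathcomp Require Import polyrcf ring lra.

(** Let p and q be the monic real-rooted polynomials at two points of the image
pencil, and d = q - p, so that p + l d is real-rooted for every real l. A double
root of a member of the pencil must be a root of all members: otherwise a small
perturbation splits it into non-real roots. Hence, when p and q have no common
root, the Wronskian p d' - p' d has no real zero and so a constant sign. This
makes the roots a_i of p simple, and all the weights w_i in the partial
fraction expansion d / p = sum_i w_i / (x - a_i) of the same sign; the
convexity of the largest root of p + t d can be read off this expansion. Common
roots are divided out. *)

(** * Values of split polynomials, and double roots in a pencil *)

Definition split_poly (F : fieldType) (p : {poly F}) : Prop :=
  exists c s, p = c *: \prod_(a <- s) ('X - a%:P).

(** The logarithmic derivative [p' / p] is the sum of the [1 / (x - a)]; the identity is its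
    derivative multiplied by [- p ^ 2]. *)
Lemma horner_prod_XsubC_deriv2 (F : fieldType) (s : seq F) (x : F)
    (p := \prod_(a <- s) ('X - a%:P)) : p.[x] != 0 ->
  p^`().[x] ^+ 2 - p.[x] * p^`()^`().[x]
    = p.[x] ^+ 2 * \sum_(a <- s) ((x - a)^-1) ^+ 2.
Proof.
rewrite {}/p; elim: s => [|a s IHs].
  by rewrite !big_nil derivC deriv0 !hornerE => _; ring.
rewrite !big_cons; set p := \prod_(_ <- _) _ in IHs *.
rewrite hornerM mulf_eq0 !hornerE => /norP[xa /IHs {}IHs].
have dX (r : {poly F}) : (('X - a%:P) * r)^`() = r + ('X - a%:P) * r^`().
  by rewrite derivM derivXsubC mul1r.
rewrite dX derivD dX !hornerD !hornerM hornerXsubC.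
have -> : (p.[x] + (x - a) * p^`().[x]) ^+ 2 = p.[x] ^+ 2 +
  2%:R * (x - a) * p.[x] * p^`().[x] + (x - a) ^+ 2 * p^`().[x] ^+ 2 by ring.
have -> : p^`().[x] ^+ 2 = p.[x] ^+ 2 * \sum_(b <- s) ((x - b)^-1) ^+ 2
    + p.[x] * p^`()^`().[x] by rewrite -IHs subrK.
by field.
Qed.

(** Each factor is [y - a = (x - a) * (1 + (y - x) / (x - a))], and [1 / (x - a)] is at most [1 + C]
    in absolute value, since its square is at most [C <= (1 + C) ^ 2]. *)
Lemma prod_XsubC_horner_bound (R : realFieldType) (s : seq R) (x y C : R) :
  (forall a, a \in s -> x - a != 0 /\ ((x - a)^-1) ^+ 2 <= C) ->
  `|(\prod_(a <- s) ('X - a%:P)).[y]|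
    <= `|(\prod_(a <- s) ('X - a%:P)).[x]| * (1 + `|y - x| * (1 + C)) ^+ size s.
Proof.
elim: s => [|a s IHs] sC; first by rewrite !big_nil !hornerE normr1.
rewrite !big_cons !hornerM !normrM exprS mulrACA ler_pM //; last first.
  by apply: IHs => b bs; apply: sC; rewrite inE bs orbT.
have [xa aC] := sC a (mem_head _ _); rewrite !hornerE.
have -> : y - a = (x - a) * (1 + (y - x) * (x - a)^-1) by field.
rewrite normrM ler_wpM2l // (le_trans (ler_normD _ _)) // normr1 lerD2l.
rewrite normrM ler_wpM2l //.
have /ger0_norm <- : 0 <= 1 + C.
  by rewrite addr_ge0 // (le_trans _ aC) // sqr_ge0.
rewrite -ler_sqr ?nnegrE // -!normrX !ger0_norm ?sqr_ge0 //.
have := sqr_ge0 (x-a)^-1; nra.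
Qed.

(* The left-hand side of the hypothesis is [p.[x] ^+ 2] times the sum of the
   [1 / (x - a) ^+ 2] over the roots [a] of [p], so [C] keeps the roots away
   from [x]. *)
Lemma split_poly_horner_bound (R : realFieldType) (p : {poly R}) (x y C : R) :
  split_poly p -> p.[x] != 0 ->
  p^`().[x] ^+ 2 - p.[x] * p^`()^`().[x] <= C * p.[x] ^+ 2 ->
  `|p.[y]| <= `|p.[x]| * (1 + `|y - x| * (1 + C)) ^+ (size p).-1.
Proof.
move=> [c [s ->]]; rewrite !derivZ !hornerZ mulf_eq0 => /norP[c0 px].
set p0 := \prod_(a <- s) _ in px *.
have -> : (c * p0^`().[x]) ^+ 2 - c * p0.[x] * (c * p0^`()^`().[x])
  = c ^+ 2 * (p0^`().[x] ^+ 2 - p0.[x] * p0^`()^`().[x]) by ring.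
rewrite horner_prod_XsubC_deriv2 // exprMn [C * (_ * _)]mulrCA.
rewrite ler_pM2l ?exprn_even_gt0 //.
rewrite mulrC ler_pM2r ?exprn_even_gt0 // => sC.
rewrite size_scale // size_prod_XsubC !normrM -mulrA ler_wpM2l //.
apply: prod_XsubC_horner_bound => a sa; split.
  have : root p0 a by rewrite root_prod_XsubC.
  by rewrite subr_eq0; apply: contraTneq => <-.
apply: le_trans sC; rewrite (big_rem a) //= lerDl sumr_ge0 // => b _.
exact: sqr_ge0.
Qed.

Lemma poly_neq0_nonroot (R : numDomainType) (p : {poly R}) : p != 0 ->
  exists x, p.[x] != 0.
Proof.
move=> p0; apply: contrapT => /forallNP pr.
suff: (size (map (fun i => i%:R : R) (iota 0 (size p))) < size p)%N.
  by rewrite size_map size_iota ltnn.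
apply: max_poly_roots => //.
  by apply/allP => x _; apply/negPn/negP; exact: pr.
rewrite map_inj_uniq ?iota_uniq // => i j /eqP.
by rewrite eqr_nat => /eqP.
Qed.

(** Were [q.[x]] nonzero, then for one sign of [e] all roots of [p + e *: q] would keep a fixed
    distance from [x] as [e] tends to 0, although the value at [x] tends to 0. This would force [p]
    to vanish everywhere. *)
Lemma split_pencil_double_root (R : realFieldType) (p q : {poly R}) (x : R) :
  (forall e, e != 0 -> split_poly (p + e *: q)) -> p != 0 ->
  p.[x] = 0 -> p^`().[x] = 0 -> q.[x] = 0.
Proof.
move=> spl /poly_neq0_nonroot[y py] px p'x; apply/eqP; apply: contraNT py => qx.
have [sg sgn sgp] : exists2 g : R,
    g ^+ 2 = 1 & 0 <= g * (q.[x] * p^`()^`().[x]).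
  have [h|/ltW h] := leP 0 (q.[x] * p^`()^`().[x]).
    by exists 1; rewrite ?expr1n ?mul1r.
  by exists (-1); rewrite ?sqrrN ?expr1n // mulN1r oppr_ge0.
(* With the sign of e chosen so that [e * q.[x] * p''.[x] >= 0], the bound
   [split_poly_horner_bound] applies to [p + e *: q] with a constant independent
   of e; since [(p + e *: q).[x]] tends to 0 with e, so does
   [(p + e *: q).[y]]. *)
pose C := (q^`().[x] ^+ 2 - q.[x] * q^`()^`().[x]) / q.[x] ^+ 2.
pose B := 1 + `|y - x| * (1 + `|C|).
pose N := maxn (size p) (size q).
have B1 : 1 <= B by rewrite lerDl mulr_ge0 // addr_ge0.
pose K := `|q.[y]| + `|q.[x]| * B ^+ N.
have bnd d : 0 < d -> `|p.[y]| <= d * K.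
  move=> d0; pose e := sg * d.
  have e2 : e ^+ 2 = d ^+ 2 by rewrite exprMn sgn mul1r.
  have ed : `|e| = d.
    apply/eqP; rewrite -(eqrXn2 (n := 2)) ?normr_ge0 ?(ltW d0) //.
    by rewrite -normrX e2 ger0_norm ?sqr_ge0.
  have e0 : e != 0 by rewrite -normr_gt0 ed.
  have fx : (p + e *: q).[x] = e * q.[x] by rewrite !hornerE px add0r.
  have := @split_poly_horner_bound _ _ x y `|C| (spl e e0).
  rewrite fx mulf_neq0 // => /(_ isT).
  have -> : (p + e *: q)^`().[x] = e * q^`().[x].
    by rewrite derivD derivZ !hornerE p'x add0r.
  have -> : (p + e *: q)^`()^`().[x] = p^`()^`().[x] + e * q^`()^`().[x].
    by rewrite !(derivD, derivZ) !hornerE.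
  have h : (e * q^`().[x]) ^+ 2
      - e * q.[x] * (p^`()^`().[x] + e * q^`()^`().[x])
       <= `|C| * (e * q.[x]) ^+ 2.
    have : C * (e * q.[x]) ^+ 2 <= `|C| * (e * q.[x]) ^+ 2.
      by rewrite ler_wpM2r ?sqr_ge0 ?ler_norm.
    apply: le_trans.
    have -> : C * (e * q.[x]) ^+ 2
        = e ^+ 2 * (q^`().[x] ^+ 2 - q.[x] * q^`()^`().[x]).
      by rewrite /C; field.
    have : 0 <= d * (sg * (q.[x] * p^`()^`().[x])) by rewrite mulr_ge0 // ltW.
    rewrite /e; lra.
  move=> /(_ h); rewrite hornerD hornerZ normrM ed => {}h.
  have : `|p.[y]| <= `|p.[y] + e * q.[y]| + `|e * q.[y]|.
    by rewrite -{1}(addrK (e * q.[y]) p.[y]) (le_trans (ler_normB _ _)).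
  rewrite normrM ed => /le_trans; apply.
  rewrite /K mulrDr addrC lerD2l (le_trans h) // -mulrA.
  rewrite ler_pM2l // ler_wpM2l // -/B ler_weXn2l //.
  rewrite (leq_trans (leq_pred _)) // (leq_trans (size_polyD _ _)) //.
  by rewrite geq_max leq_maxl (leq_trans (size_scale_leq _ _)) ?leq_maxr.
have K0 : 0 <= K.
  by rewrite addr_ge0 // mulr_ge0 // exprn_ge0 // (le_trans _ B1).
rewrite -normr_le0 leNgt; apply/negP => py.
(* This choice of [d] makes [d * K] smaller than [|p.[y]|], as [K < 2 * (K + 1)]. *)
have /bnd : 0 < `|p.[y]| / (2%:R * (K + 1)).
  by rewrite divr_gt0 // mulr_gt0 // ltr_wpDl.
apply/negP; rewrite -ltNge mulrAC ltr_pdivrMr ?ltr_pM2l //; last first.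
  by rewrite mulr_gt0 // ltr_wpDl.
lra.
Qed.

(** * The Wronskian of a pencil *)

Lemma split_polyZ (F : fieldType) (c : F) (p : {poly F}) :
  split_poly p -> split_poly (c *: p).
Proof. by move=> [d [s ->]]; exists (c * d), s; rewrite scalerA. Qed.

(** A zero [x] of the Wronskian is a double root of a member of the pencil: of [q] if [q.[x] = 0],
    and of [p - (p.[x] / q.[x]) *: q] otherwise. All members then vanish at [x], which is
    excluded. *)
Lemma split_pencil_wronskian_neq0 (R : realFieldType) (p q : {poly R}) (x : R) :
  (forall l, split_poly (p + l *: q)) -> (forall l, p + l *: q != 0) ->
  q != 0 -> (p.[x] = 0 -> q.[x] != 0) -> (p * q^`() - p^`() * q).[x] != 0.
Proof.
move=> spl p0 q0 pq; apply/eqP; rewrite !hornerE => w0.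
have [qx|qx] := eqVneq q.[x] 0.
  have px : p.[x] != 0 by apply: contra_eq_neq qx => /pq.
  move/eqP: w0; rewrite qx mulr0 subr0 mulf_eq0 (negPf px) => /= /eqP q'x.
  move/eqP: px; apply; apply: (@split_pencil_double_root _ q p) => // e e0.
  have -> : q + e *: p = e *: (p + e^-1 *: q).
    by rewrite scalerDr scalerA divff // scale1r addrC.
  exact: split_polyZ.
pose l := - p.[x] / q.[x]; move/eqP: (qx); apply.
apply: (@split_pencil_double_root _ (p + l *: q) q) => //.
- by move=> e _; rewrite -addrA -scalerDl.
- by rewrite !hornerE /l divfK // subrr.
- rewrite derivD derivZ !hornerE /l; apply: (mulIf qx).
  rewrite mul0r -[RHS]oppr0 -w0.
  by field.
Qed.

Lemma neq0_poly_same_sign (R : rcfType) (p : {poly R}) :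
  (forall x, p.[x] != 0) -> (forall x, 0 < p.[x]) \/ (forall x, p.[x] < 0).
Proof.
move=> p0.
have sg a b : a <= b -> 0 < p.[a] * p.[b].
  move=> ab; rewrite lt0r mulf_neq0 //= leNgt; apply/negP => h.
  by have [x _] := poly_ivtoo ab h; rewrite /root (negPf (p0 x)).
have sg' a b : 0 < p.[a] * p.[b].
  by have /orP[/sg//|/sg] := le_total a b; rewrite mulrC.
have [h|h|/eqP] := ltrgtP 0 p.[0]; last by rewrite eq_sym (negPf (p0 0)).
  by left => x; have := sg' 0 x; rewrite pmulr_rgt0.
by right => x; have := sg' 0 x; rewrite nmulr_rgt0.
Qed.

(** * Simple roots and partial fractions *)

Lemma prod_XsubC_simple (F : fieldType) (s : seq F) :
  (forall a, a \in s -> (\prod_(b <- s) ('X - b%:P))^`().[a] != 0) -> uniq s.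
Proof.
elim: s => //= b s IHs; rewrite big_cons; set p := \prod_(_ <- _) _ in IHs *.
have -> : (('X - b%:P) * p)^`() = p + ('X - b%:P) * p^`().
  by rewrite derivM derivXsubC mul1r.
move=> h; apply/andP; split.
  have := h b (mem_head _ _); rewrite !hornerE subrr mul0r addr0.
  by apply: contra => bs; rewrite -/(root p b) root_prod_XsubC.
apply: IHs => a sa; have := h a; rewrite inE sa orbT => /(_ isT).
have /eqP pa : root p a by rewrite root_prod_XsubC.
by rewrite !hornerE pa add0r mulf_eq0 => /norP[].
Qed.

(** Lagrange interpolation at the nodes [s]: [p'.[a]] is the product of the [a - b] over the other
    nodes [b], and two polynomials of size at most [size s] that agree on [s] are equal. *)
Lemma partial_fraction (F : fieldType) (s : seq F) (q : {poly F}) (x : F)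
    (p := \prod_(a <- s) ('X - a%:P)) :
  uniq s -> (size q <= size s)%N -> p.[x] != 0 ->
  q.[x] = p.[x] * \sum_(a <- s) q.[a] / p^`().[a] / (x - a).
Proof.
move=> us qs px.
pose pr a := \prod_(b <- s | b != a) ('X - b%:P).
have pE a : a \in s -> p = ('X - a%:P) * pr a.
  by move=> sa; rewrite /p (bigD1_seq a).
have p'E a : a \in s -> p^`().[a] = (pr a).[a].
  move=> sa; rewrite (pE a) // derivM derivXsubC mul1r.
  by rewrite !hornerE subrr mul0r addr0.
have prn a : (pr a).[a] != 0.
  rewrite horner_prod prodf_seq_neq0; apply/allP => b _; apply/implyP.
  by rewrite !hornerE subr_eq0 eq_sym.
have pr0 a b : a \in s -> b \in s -> a != b -> (pr a).[b] = 0.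
  move=> sa sb ab; apply/eqP; rewrite horner_prod prodf_seq_eq0; apply/hasP.
  by exists b => //; rewrite !hornerE subrr eqxx eq_sym ab.
have qE : q = \sum_(a <- s) (q.[a] / p^`().[a]) *: pr a.
  apply/eqP; rewrite -subr_eq0; apply: contraT => d0.
  suff : (size s < size s)%N by rewrite ltnn.
  apply: leq_trans (max_poly_roots d0 _ us) _.
    apply/allP => b sb; rewrite /root hornerD hornerN horner_sum.
    rewrite (bigD1_seq b sb us) /=.
    rewrite big_seq_cond big1 => [|a /andP[sa ab]]; last first.
      by rewrite hornerZ pr0 // mulr0.
    by rewrite hornerZ p'E // divfK // addr0 subrr.
  rewrite (leq_trans (size_polyD _ _)) // geq_max qs size_polyN.
  apply: leq_trans (size_sum _ _ _) _; apply/bigmax_leqP_seq => a sa _.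
  rewrite (leq_trans (size_scale_leq _ _)) //.
  have := size_prod_XsubC s id.
  rewrite -/p (pE a) // size_monicM ?monicXsubC //.
    by rewrite size_XsubC /= => -[<-].
  apply/negP => /eqP h; move: (prn a); rewrite h horner0 eqxx //.
rewrite {1}qE horner_sum mulr_sumr big_seq [RHS]big_seq.
apply: eq_bigr => a sa; rewrite hornerZ.
have xa : x - a != 0.
  by move: px; rewrite (pE a) // !hornerE mulf_eq0 => /norP[].
have := p'E a sa; have := prn a; move: (p^`().[a]) => w ? -> .
by rewrite [in RHS](pE a) // hornerM hornerXsubC; field; apply/andP.
Qed.

(** * Convexity of the largest root along a real pencil *)

Lemma prod_XsubC_gt0 (R : numDomainType) (s : seq R) (u x : R) :
  (forall a, a \in s -> a <= u) -> u < x ->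
  0 < (\prod_(a <- s) ('X - a%:P)).[x].
Proof.
move=> su ux; rewrite horner_prod big_seq prodr_gt0 // => a sa.
by rewrite !hornerE subr_gt0 (le_lt_trans (su a sa)).
Qed.

Lemma prod_XsubC_ge0 (R : numDomainType) (s : seq R) (u x : R) :
  (forall a, a \in s -> a <= u) -> u <= x ->
  0 <= (\prod_(a <- s) ('X - a%:P)).[x].
Proof.
move=> su ux; rewrite horner_prod big_seq prodr_ge0 // => a sa.
by rewrite !hornerE subr_ge0 (le_trans (su a sa)).
Qed.

(** The ends of the segment are [p] and [p + d]; nonvanishing of [d] on [s] says that they share no
    root. *)
Lemma pencil_gt0_coprime_le (R : rcfType) (s r : seq R) (d : {poly R})
    (t u v x : R) (p := \prod_(a <- s) ('X - a%:P)) :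
  (size d <= size s)%N -> (forall a, a \in s -> d.[a] != 0) ->
  (forall l, split_poly (p + l *: d)) ->
  p + d = \prod_(a <- r) ('X - a%:P) ->
  (forall a, a \in s -> a <= u) -> (forall a, a \in r -> a <= v) ->
  0 <= t <= 1 -> u <= v -> (1 - t) * u + t * v < x ->
  0 < (p + t *: d).[x].
Proof.
move=> ds d0 spl pd su rv /andP[t0 t1] uv tx.
have ux : u < x by apply: le_lt_trans tx; nra.
have px : 0 < p.[x] := prod_XsubC_gt0 su ux.
case s0 : s => [|a0 s'].
  have -> : d = 0 by apply/eqP; rewrite -size_poly_leq0; move: ds; rewrite s0.
  by rewrite scaler0 addr0.
have sa0 : a0 \in s by rewrite s0 mem_head.
have dn0 : d != 0 by apply: contraNneq (d0 _ sa0) => ->; rewrite horner0.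
have sp : size p = (size s).+1 by rewrite size_prod_XsubC.
have pn0 l : p + l *: d != 0.
  rewrite -size_poly_eq0 size_polyDl sp //.
  by rewrite ltnS (leq_trans (size_scale_leq _ _)).
have pr a : p.[a] = 0 -> a \in s.
  by move/eqP; rewrite -/(root p a) root_prod_XsubC.
have W0 y := @split_pencil_wronskian_neq0 _ p d y spl pn0 dn0
  (fun h => d0 _ (pr _ h)).
set W := _ - _ in W0.
have Wa a : a \in s -> W.[a] = - (p^`().[a] * d.[a]).
  move=> sa; have /eqP pa : root p a by rewrite root_prod_XsubC.
  by rewrite /W !hornerE pa mul0r add0r.
have p'0 a : a \in s -> p^`().[a] != 0.
  by move=> sa; move: (W0 a); rewrite Wa // oppr_eq0 mulf_eq0 => /norP[].
have us : uniq s by apply: prod_XsubC_simple.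
have wE a : a \in s -> d.[a] / p^`().[a] = - W.[a] / p^`().[a] ^+ 2.
  by move=> sa; rewrite Wa //; have := p'0 a sa => ?; field.
pose S y := \sum_(a <- s) d.[a] / p^`().[a] / (y - a).
have dS y : u < y -> d.[y] = p.[y] * S y.
  move=> uy; apply: partial_fraction => //.
  by rewrite gt_eqF // (prod_XsubC_gt0 su).
have xa y a : u < y -> a \in s -> 0 < y - a.
  by move=> uy sa; rewrite subr_gt0 (le_lt_trans (su a sa)).
have p'2 a : a \in s -> 0 < p^`().[a] ^+ 2.
  by move=> sa; rewrite exprn_even_gt0 //= p'0.
(* The value is [p.[x] * (1 + t * S x)], so the goal becomes [0 < 1 + t * S x]. *)
rewrite hornerD hornerZ dS // mulrCA -{1}[p.[x]]mulr1 -mulrDr pmulr_rgt0 //.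
(* The weights have the sign opposite to [W]. If [W] is negative, then [S x >= 0]. *)
have [Wp|Wn] := neq0_poly_same_sign W0; last first.
  rewrite ltr_wpDr // mulr_ge0 // /S big_seq sumr_ge0 // => a sa.
  rewrite divr_ge0 ?(ltW (xa _ _ ux sa)) // wE // divr_ge0 ?(ltW (p'2 a sa)) //.
  by rewrite oppr_ge0 ltW.
(* From here on the weights are nonpositive. Beyond [v] both ends are positive, and [1 + t * S x] is
   a convex combination of [1] and [1 + S x]. *)
have [vx|xv] := ltP v x.
  have : 0 < (p + d).[x] by rewrite pd (prod_XsubC_gt0 rv).
  rewrite hornerD dS // -{1}[p.[x]]mulr1 -mulrDr pmulr_rgt0 // => S1.
  have -> : 1 + t * S x = (1 - t) + t * (1 + S x) by ring.
  have [->|tn] := eqVneq t 0; first by rewrite subr0 mul0r addr0.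
  by rewrite ltr_wpDl ?subr_ge0 // mulr_gt0 // lt0r tn.
have pv : 0 < p.[v] by rewrite (prod_XsubC_gt0 su) // (lt_le_trans ux).
have uv' : u < v := lt_le_trans ux xv.
have Sv : - S v <= 1.
  have : 0 <= (p + d).[v] by rewrite pd (prod_XsubC_ge0 rv).
  by rewrite hornerD dS // -{1}[p.[v]]mulr1 -mulrDr pmulr_rge0 // => ?; lra.
(* [t / (x - a) <= k / (v - a)] for every root [a <= u] of [p]. *)
pose k := t * (v - u) / (x - u).
have xu : 0 < x - u by rewrite subr_gt0.
have k0 : 0 <= k by rewrite /k divr_ge0 ?(ltW xu) // mulr_ge0 // subr_ge0.
(* The hypothesis on [x] reads [t * (v - u) < x - u]. *)
have k1 : k < 1 by rewrite /k ltr_pdivrMr // mul1r; lra.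
suff : t * - S x <= k * - S v by have := ler_wpM2l k0 Sv; lra.
rewrite /S -!sumrN !mulr_sumr big_seq [leRHS]big_seq ler_sum // => a sa.
have va := xa v a uv' sa; have xa0 := xa x a ux sa; have au := su a sa.
have : d.[a] / p^`().[a] <= 0.
  by rewrite wE // mulNr oppr_le0 divr_ge0 ?(ltW (Wp a)) // ltW ?p'2.
move: (d.[a] / _) => c c0.
have -> : t * - (c / (x - a)) = - c * (t / (x - a)) by ring.
have -> : k * - (c / (v - a)) = - c * (k / (v - a)) by ring.
rewrite ler_wpM2l ?oppr_ge0 // ler_pdivrMr // [k / _ * _]mulrAC ler_pdivlMr //.
(* What remains amounts to [0 <= (v - x) * (u - a)]. *)
rewrite /k mulrAC ler_pdivlMr // -!mulrA ler_wpM2l //; nra.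
Qed.

Lemma size_sub_monic (R : nzRingType) (n : nat) (p q : {poly R}) :
  p \is monic -> q \is monic -> size p = n.+1 -> size q = n.+1 ->
  (size (q - p)%R <= n)%N.
Proof.
move=> pm qm ps qs; apply/leq_sizeP => j.
rewrite leq_eqVlt coefB => /orP[/eqP <-|nj].
  have := monicP pm; have := monicP qm; rewrite /lead_coef ps qs /= => -> ->.
  exact: subrr.
by rewrite !nth_default ?subrr // ?ps ?qs.
Qed.

(** Induction on the degree, dividing out a common root if there is one. Taking [u] and [v] to be
    mere upper bounds of the roots lets them survive this division. *)
Lemma pencil_gt0 (R : rcfType) (n : nat) (p q : {poly R}) (t u v x : R) :
  (forall l, exists2 s, size s = n
     & (1 - l) *: p + l *: q = \prod_(a <- s) ('X - a%:P)) ->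
  (forall a, root p a -> a <= u) -> (forall a, root q a -> a <= v) ->
  0 <= t <= 1 -> (1 - t) * u + t * v < x ->
  0 < ((1 - t) *: p + t *: q).[x].
Proof.
elim: n p q => [|n IHn] p q spl pu qv t01 tx.
  by have [s /size0nil -> ->] := spl t; rewrite big_nil hornerE.
have [s ss] := spl 0; rewrite subr0 scale1r scale0r addr0 => pE.
have [r sr] := spl 1; rewrite subrr scale1r scale0r add0r => qE.
have [[c pc qc]|pq] := pselect (exists2 c, root p c & root q c).
  have /factor_theorem[p1 p1E] := pc; have /factor_theorem[q1 q1E] := qc.
  have fE l : (1 - l) *: p + l *: q = ('X - c%:P) * ((1 - l) *: p1 + l *: q1).
    by rewrite p1E q1E -!mul_polyC; ring.
  rewrite fE hornerM hornerXsubC mulr_gt0 //.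
    move: (pu c pc) (qv c qc); rewrite subr_gt0; case/andP: t01 => t0 t1 cu cv.
    by apply: le_lt_trans tx; nra.
  apply: IHn => // [l|a|a]; last 2 first.
  - by move=> pa; apply: pu; rewrite p1E rootM pa.
  - by move=> qa; apply: qv; rewrite q1E rootM qa.
  have [sl ssl slE] := spl l; have csl : c \in sl.
    by rewrite -root_prod_XsubC -slE fE rootM root_XsubC eqxx.
  exists (rem c sl); first by rewrite size_rem // ssl.
  have cn0 : 'X - c%:P != 0 by rewrite monic_neq0 // monicXsubC.
  apply: (mulfI cn0).
  by rewrite -fE slE (big_rem c).
have pE' l : p + l *: (q - p) = (1 - l) *: p + l *: q.
  by rewrite -!mul_polyC; ring.
have qE' l : q + (1 - l) *: (p - q) = (1 - l) *: p + l *: q.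
  by rewrite -!mul_polyC; ring.
have splp l : split_poly ((1 - l) *: p + l *: q).
  by have [sl _ ->] := spl l; exists 1, sl; rewrite scale1r.
have szp : size p = n.+2 by rewrite pE size_prod_XsubC ss.
have szq : size q = n.+2 by rewrite qE size_prod_XsubC sr.
have pm : p \is monic by rewrite pE monic_prod_XsubC.
have qm : q \is monic by rewrite qE monic_prod_XsubC.
have su a : a \in s -> a <= u by rewrite -root_prod_XsubC -pE; exact: pu.
have rv a : a \in r -> a <= v by rewrite -root_prod_XsubC -qE; exact: qv.
(* The case [v <= u] follows by exchanging [p] with [q] and [t] with [1 - t]. *)
have [uv|/ltW vu] := leP u v.
  rewrite -pE' [X in X + _]pE.
  apply: (pencil_gt0_coprime_le (r := r) (u := u) (v := v)) => //.
  - by rewrite ss size_sub_monic.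
  - move=> a sa; have pa : root p a by rewrite pE root_prod_XsubC.
    apply/eqP; rewrite hornerD hornerN (eqP pa) subr0 => /eqP qa.
    by apply: pq; exists a.
  - by move=> l; rewrite -pE pE'.
  - by rewrite -pE -qE addrC subrK.
rewrite -qE' [X in X + _]qE.
apply: (pencil_gt0_coprime_le (r := s) (u := v) (v := u)) => //.
- by rewrite sr size_sub_monic.
- move=> a ra; have qa : root q a by rewrite qE root_prod_XsubC.
  apply/eqP; rewrite hornerD hornerN (eqP qa) subr0 => /eqP pa.
  by apply: pq; exists a.
- by move=> l; rewrite -qE -[l](subKr 1) qE'.
- by rewrite -pE -qE addrC subrK.
- by case/andP: t01 => ? ?; apply/andP; split; lra.
- by rewrite subKr addrC.
Qed.

(** * Hyperbolic complex polynomials and the twisted root map *)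

(** The zeros are real, hence equal to their real parts; this moves the argument from [R[i]] to
    [R]. *)
Lemma hyperbolic_prod (R : realType) (n : nat) (P : {poly R[i]}) :
  hyperbolic_poly n P -> exists s : n.-tuple R,
    P = map_poly (real_complex R) (\prod_(a <- s) ('X - a%:P)).
Proof.
move=> [[Pm _] Pr]; have [t tP] := monic_poly_prod Pm.
exists [tuple of map (@complex.Re R) t]; rewrite tP rmorph_prod /= big_map.
rewrite big_seq [RHS]big_seq; apply: eq_bigr => z zt.
rewrite rmorphB /= map_polyX map_polyC /=.
by rewrite (@RRe_real _ z) // Pr // tP root_prod_XsubC.
Qed.

Theorem theorem2 (R : realType) (n : nat) (hn : (2 <= n)%N)
    (L : set {poly R[i]}) (hL : pencil n L) (hLH : L `<=` hyperbolic_poly n)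
    (T : {linear {poly R[i]} -> {poly R[i]}})
    (hT : hyperbolicity_preserver n T) :
  exists f : {poly R[i]} -> symtuple n R,
    (forall P, L P -> symmap (real_complex R) (f P) = root_map n (T P)) /\
    garding_convex (E := realify {poly R[i]}) L f.
Proof.
pose toP (s : n.-tuple R) := \prod_(a <- s) ('X - a%:P).
have TL P : L P -> exists s, T P = map_poly (real_complex R) (toP s).
  by move=> /hLH LP; apply: hyperbolic_prod; apply: hT; exists P.
(* [g P] lists the real zeros of [T P]; outside [L] it is a dummy tuple. *)
have /choice[g gE] : forall P, exists s,
    L P -> T P = map_poly (real_complex R) (toP s).
  move=> P.
  have [/TL[s sE]|nLP] := pselect (L P); first by exists s.
  by exists (nseq_tuple n 0).
have Laff P Q l : L P -> L Q -> L ((1 - l)%:C *: P + l%:C *: Q).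
  have [P1 [P2 [_ _ _ ->]]] := hL; move=> [a _ <-] [b _ <-].
  exists ((1 - l) * a + l * b) => //.
  rewrite !(rmorphB, rmorphD, rmorphM, rmorph1) -!mul_polyC.
  rewrite !(rmorphB, rmorphD, rmorphM, rmorph1) /=; ring.
exists (fun P => sympi (g P)); split.
  move=> P LP; rewrite symmap_pi gE // /toP rmorph_prod /=.
  rewrite -(@root_map_prod R n (map_tuple (real_complex R) (g P))) /= big_map.
  congr root_map; apply: eq_bigr => a _.
  by rewrite rmorphB /= map_polyX map_polyC.
(* [conv] puts the weight [t] on its first argument, so [Q] takes the place of the end at parameter
   0. *)
have convE (t : {i01 R}) (P Q : realify {poly R[i]}) :
    conv t (P : convex_lmodType (realify {poly R[i]})) Q
    = (1 - t%:num)%:C *: (Q : {poly R[i]}) + t%:num%:C *: (P : {poly R[i]}).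
  exact: addrC.
split=> [P Q t|t P Q]; rewrite !in_setE => LP LQ.
  by rewrite convE; apply: Laff.
rewrite !symmax_pi convE convRE [leRHS]addrC.
(* By linearity [T] maps the line through [Q] and [P] affinely, and coefficients can be compared
   over [R]. *)
have toP_aff l : toP (g ((1 - l)%:C *: (Q : {poly R[i]}) + l%:C *: P))
    = (1 - l) *: toP (g Q) + l *: toP (g P).
  apply: (@map_poly_inj _ _ (real_complex R)).
  rewrite -gE; last exact: Laff.
  rewrite linearD !linearZ /= !gE // [RHS]rmorphD /=.
  by rewrite !map_polyZ.
have g0 P0 : tval (g P0) != [::].
  by rewrite -size_eq0 size_tuple -lt0n (leq_trans _ hn).
have gmax P0 a : root (toP (g P0)) a -> a <= seqmax (g P0).
  by rewrite root_prod_XsubC; apply: (seqmaxP (g0 P0)).2.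
set Z := _ + _ *: _; have [zg _] := seqmaxP (g0 Z).
have : root (toP (g Z)) (seqmax (g Z)) by rewrite root_prod_XsubC.
(* If the largest root at [Z] exceeded the convex combination of the largest roots, [pencil_gt0]
   would make the polynomial positive at its own root. *)
rewrite /Z toP_aff -/Z leNgt => /eqP z0; apply/negP => /pencil_gt0 zgt.
suff : 0 < ((1 - t%:num) *: toP (g Q) + t%:num *: toP (g P)).[seqmax (g Z)].
  by rewrite z0 ltxx.
apply: (zgt n) => [l|||]; [|exact: gmax|exact: gmax|exact/andP].
(* Splitting is required for every real [l], also outside the unit interval; [L] contains the whole
   line. *)
rewrite -toP_aff.
exists (g ((1 - l)%:C *: (Q : {poly R[i]}) + l%:C *: P)) => //.
by rewrite size_tuple.
Qed.
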